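(* Let $p\ge 7$ be a prime. Then $$\sum_{k=1}^{p-1}\frac{H_k}{k^2}\equiv \sum_{k=1}^{p-1}\frac{H_k^2}{k}\equiv -\frac{3}{p^2}\sum_{k=1}^{p-1}\frac{1}{k}\equiv \frac{3}{2p}\sum_{k=1}^{p-1}\frac{1}{k^2}\pmod{p^2}.$$
   Context: For positive integers $n,m$, $H_{n,m}=\sum_{k=1}^n 1/k^m$ and $H_n=H_{n,1}=\sum_{k=1}^n 1/k$; also $H_0=H_{0,m}=0$. Congruences modulo a prime power $p^e$ are taken in the ring of rational numbers whose denominators are not divisible by $p$: for such rationals $a,b$, $a\equiv b\pmod{p^e}$ means $a-b=p^e c$ with $c$ a rational whose denominator is not divisible by $p$. (The expressions $-\frac{3}{p^2}H_{p-1}$ and $\frac{3}{2p}H_{p-1,2}$ are $p$-integral for $p\ge 7$, since $p^2\mid H_{p-1}$ and $p\mid H_{p-1,2}$.) *)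

(* Defs.v *)
From HB Require Import structures.
From mathcomp Require Import all_boot all_order all_algebra.
Set Implicit Arguments. Unset Strict Implicit. Unset Printing Implicit Defensive.
Import Order.TTheory GRing.Theory Num.Theory.
Local Open Scope ring_scope.

Definition harm2 (n m : nat) : rat := \sum_(1 <= k < n.+1) (k%:R ^+ m)^-1.
Definition harm (n : nat) : rat := harm2 n 1.

Definition p_integral (p : nat) (x : rat) : bool := ~~ (p %| `|denq x|)%N.

Definition cong_rat (p e : nat) (a b : rat) : Prop :=
  p_integral p ((a - b) / (p%:R ^+ e)).

(* Main.v *)
(* Write P_k(X) = prod_(j <= k) (1 - X / j) and Q(X) = sum_(k < p) P_k(X) / k.
   Then Q(m) = - H_(m-1) for 1 <= m <= p, while the coefficients of 1, X, X^2
   in Q are expressed by H_(p-1), H_(p-1,2), H_(p-1,3) and the two sums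
   S1 = sum H_k / k^2, S2 = sum H_k^2 / k.  The coefficient of X^3 is divisible
   by p: it is - sum_m Q(m) / m^3 = sum_m H_(m-1) / m^3 modulo p, which vanishes
   by the reflection m -> p - m.  So Q(p) = - H_(p-1) is a relation modulo p^4
   from which S1 + S2 can be read off modulo p^2; the difference S1 - S2
   telescopes, and the reflection k -> p - k gives
   2 H_(p-1) + p H_(p-1,2) = 0 modulo p^4. *)
Require Import Defs.
From HB Require Import structures.
From mathcomp Require Import all_boot all_order all_algebra.
From mathcomp Require Import cyclic ring zify.
Set Implicit Arguments. Unset Strict Implicit. Unset Printing Implicit Defensive.
Import Order.TTheory GRing.Theory Num.Theory.
Local Open Scope ring_scope.

(** * Telescoping identities for harmonic sums *)

Lemma harm2S n a : harm2 n.+1 a = harm2 n a + (n.+1%:R ^+ a)^-1.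
Proof. by rewrite /harm2 big_nat_recr. Qed.

Lemma harmS n : harm n.+1 = harm n + n.+1%:R^-1.
Proof. by rewrite /harm harm2S expr1. Qed.

Lemma harm2_0 a : harm2 0 a = 0.
Proof. by rewrite /harm2 big_geq. Qed.

(** Telescopes [H_k^2 - H_(k-1)^2 = 2 H_k / k - 1 / k^2]. *)
Lemma sum_harm n :
  \sum_(1 <= k < n.+1) harm k / k%:R = (harm n ^+ 2 + harm2 n 2) / 2%:R.
Proof.
elim: n => [|n IH]; first by rewrite big_geq // /harm !harm2_0; field.
by rewrite big_nat_recr //= IH harmS harm2S; field; rewrite nat1r pnatr_eq0.
Qed.

(** Telescopes [H_k^3 - H_(k-1)^3 = 3 H_k^2 / k - 3 H_k / k^2 + 1 / k^3]; this relates [S1] and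
    [S2]. *)
Lemma sum_sqr_harm n :
  \sum_(1 <= k < n.+1) harm k ^+ 2 / k%:R =
  \sum_(1 <= k < n.+1) harm k / k%:R ^+ 2 + (harm n ^+ 3 - harm2 n 3) / 3%:R.
Proof.
elim: n => [|n IH]; first by rewrite !big_geq // /harm !harm2_0; field.
by rewrite !(big_nat_recr n.+1) //= IH harmS harm2S; field; rewrite nat1r pnatr_eq0.
Qed.

(** Summation by parts, from the increments of [H_k H_(k,2)]. *)
Lemma sum_harm2 n :
  \sum_(1 <= k < n.+1) harm2 k 2 / k%:R =
  harm n * harm2 n 2 + harm2 n 3 - \sum_(1 <= k < n.+1) harm k / k%:R ^+ 2.
Proof.
elim: n => [|n IH]; first by rewrite !big_geq // /harm !harm2_0; field.
by rewrite !(big_nat_recr n.+1) //= IH harmS !harm2S; field; rewrite nat1r pnatr_eq0.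
Qed.

(** * The polynomials [P_k] and [Q]: shift relation and values at integers *)

(* At [m >= 1] its value is [(-1)^k 'C(m-1, k)]. *)
Definition binom_poly (k : nat) : {poly rat} :=
  \prod_(1 <= j < k.+1) (1 - j%:R^-1 *: 'X).

(** The polynomial [Q] is the case [n = p - 1]. *)
Definition binom_sum_poly (n : nat) : {poly rat} :=
  \sum_(1 <= k < n.+1) k%:R^-1 *: binom_poly k.

Lemma binom_polyS k : binom_poly k.+1 = binom_poly k * (1 - k.+1%:R^-1 *: 'X).
Proof. by rewrite /binom_poly big_nat_recr. Qed.

Lemma binom_poly0 : binom_poly 0 = 1.
Proof. by rewrite /binom_poly big_geq. Qed.

Lemma horner_binom_polyS k x :
  (binom_poly k.+1).[x] = (binom_poly k).[x] * (1 - x / k.+1%:R).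
Proof. by rewrite binom_polyS !hornerE [x / _]mulrC. Qed.

(** The factor [j = 1] becomes [- x]; for [j >= 2], [1 - (x + 1) / j = ((j - 1) / j) (1 - x / (j -
    1))], and the ratios [(j - 1) / j] multiply to [1 / (k + 1)]. *)
Lemma horner_binom_poly_shift k x :
  (binom_poly k.+1).[x + 1] = - (x / k.+1%:R) * (binom_poly k).[x].
Proof.
elim: k => [|k IH]; first by rewrite horner_binom_polyS binom_poly0 !hornerE; field.
rewrite horner_binom_polyS IH horner_binom_polyS -(natr1 k.+1) -(natr1 k).
by field; rewrite !natr1 !pnatr_eq0.
Qed.

Lemma binom_poly_root k m : (0 < m <= k)%N -> (binom_poly k).[m%:R] = 0.
Proof.
move=> /andP [m0]; elim: k => [|k IH]; first by case: m m0.
rewrite leq_eqVlt horner_binom_polyS => /predU1P [->|mk]; last by rewrite IH ?mul0r.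
by rewrite divff ?subrr ?mulr0 // pnatr_eq0.
Qed.

(** By the shift relation the term of index [k] contributes [- (x / k) P_(k-1)(x) = P_k(x) -
    P_(k-1)(x)], so the sum telescopes. *)
Lemma horner_binom_sum_poly_shift n x :
  x * ((binom_sum_poly n).[x + 1] - (binom_sum_poly n).[x]) = (binom_poly n).[x] - 1.
Proof.
elim: n => [|n IH].
  by rewrite /binom_sum_poly big_geq // binom_poly0 !hornerE; ring.
rewrite /binom_sum_poly !(big_nat_recr n.+1) //= -/(binom_sum_poly n).
rewrite !(hornerD, hornerZ) horner_binom_poly_shift horner_binom_polyS.
transitivity (x * ((binom_sum_poly n).[x + 1] - (binom_sum_poly n).[x]) -
   x / n.+1%:R * (binom_poly n).[x]); last by rewrite IH; ring.
by field; rewrite nat1r pnatr_eq0.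
Qed.

(** At an integer [1 <= x <= n] the polynomial [P_n] vanishes, so the difference equation says that
    the value drops by [1 / x] from [x] to [x + 1], starting from [0] at [1]. *)
Lemma horner_binom_sum_poly n m :
  (m <= n)%N -> (binom_sum_poly n).[m.+1%:R] = - harm m.
Proof.
elim: m => [_|m IH mn].
  rewrite /harm harm2_0 oppr0 horner_sum big1_seq // => k /andP [_].
  rewrite mem_index_iota hornerZ; case: k => // k _.
  (* Reading the point [1] as [0 + 1] makes the factor [x] of the shift relation zero. *)
  by rewrite -[1]add0r horner_binom_poly_shift mul0r oppr0 mul0r mulr0.
have := horner_binom_sum_poly_shift n m.+1%:R.
rewrite binom_poly_root ?mn // natr1 IH ?(ltnW mn) // harmS => e.
have m0 : m.+1%:R != 0 :> rat by rewrite pnatr_eq0.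
apply: (mulfI m0); rewrite mulrN mulrDr divff //.
transitivity (m.+1%:R * ((binom_sum_poly n).[m.+2%:R] - - harm m) - m.+1%:R * harm m).
  by ring.
by rewrite e; ring.
Qed.

(** * Low coefficients of [P_k] and [Q] *)

Lemma coef0_binom_poly k : (binom_poly k)`_0 = 1.
Proof.
elim: k => [|k IH]; first by rewrite binom_poly0 coef1.
by rewrite binom_polyS mulrBr mulr1 -scalerAr coefB coefZ coefMX /= IH mulr0 subr0.
Qed.

Lemma coefS_binom_polyS k i :
  (binom_poly k.+1)`_i.+1 = (binom_poly k)`_i.+1 - k.+1%:R^-1 * (binom_poly k)`_i.
Proof. by rewrite binom_polyS mulrBr mulr1 -scalerAr coefB coefZ coefMX. Qed.

Lemma coef1_binom_poly k : (binom_poly k)`_1 = - harm k.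
Proof.
elim: k => [|k IH]; first by rewrite binom_poly0 coef1 /harm harm2_0 oppr0.
by rewrite coefS_binom_polyS IH coef0_binom_poly harmS; ring.
Qed.

(** This is the second elementary symmetric function of the [1 / j], in Newton's form. *)
Lemma coef2_binom_poly k : (binom_poly k)`_2 = (harm k ^+ 2 - harm2 k 2) / 2%:R.
Proof.
elim: k => [|k IH]; first by rewrite binom_poly0 coef1 /harm !harm2_0 /=; field.
rewrite coefS_binom_polyS IH coef1_binom_poly harmS harm2S.
by field; rewrite nat1r pnatr_eq0.
Qed.

Lemma size_binom_poly k : (size (binom_poly k) <= k.+1)%N.
Proof.
elim: k => [|k IH]; first by rewrite binom_poly0 size_poly1.
rewrite binom_polyS; apply: leq_trans (size_polyMleq _ _) _.
have : (size (1 - k.+1%:R^-1 *: 'X : {poly rat})%R <= 2)%N.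
  apply: leq_trans (size_polyD _ _) _; rewrite geq_max size_poly1 size_polyN /=.
  by apply: leq_trans (size_scale_leq _ _) _; rewrite size_polyX.
lia.
Qed.

Lemma size_binom_sum_poly n : (size (binom_sum_poly n) <= n.+1)%N.
Proof.
apply: leq_trans (size_sum _ _ _) _; apply/bigmax_leqP_seq => k.
rewrite mem_index_iota => hk _; apply: leq_trans (size_scale_leq _ _) _.
by apply: leq_trans (size_binom_poly k) _; lia.
Qed.

Lemma coef_binom_sum_poly n i :
  (binom_sum_poly n)`_i = \sum_(1 <= k < n.+1) k%:R^-1 * (binom_poly k)`_i.
Proof. by rewrite coef_sum; under eq_bigr => k _ do rewrite coefZ. Qed.

Lemma coef0_binom_sum_poly n : (binom_sum_poly n)`_0 = harm n.
Proof.
rewrite coef_binom_sum_poly; apply: eq_bigr => k _.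
by rewrite coef0_binom_poly mulr1 expr1.
Qed.

Lemma coef1_binom_sum_poly n :
  (binom_sum_poly n)`_1 = - ((harm n ^+ 2 + harm2 n 2) / 2%:R).
Proof.
rewrite coef_binom_sum_poly -sum_harm -sumrN; apply: eq_bigr => k _.
by rewrite coef1_binom_poly mulrN mulrC.
Qed.

Lemma coef2_binom_sum_poly n :
  (binom_sum_poly n)`_2 =
  (\sum_(1 <= k < n.+1) harm k ^+ 2 / k%:R + \sum_(1 <= k < n.+1) harm k / k%:R ^+ 2
   - harm n * harm2 n 2 - harm2 n 3) / 2%:R.
Proof.
transitivity ((\sum_(1 <= k < n.+1) harm k ^+ 2 / k%:R -
               \sum_(1 <= k < n.+1) harm2 k 2 / k%:R) / 2%:R); last first.
  by rewrite sum_harm2; congr (_ / _); ring.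
rewrite coef_binom_sum_poly mulrBl !mulr_suml -sumrB; apply: eq_bigr => k _.
by rewrite coef2_binom_poly -mulrBl -mulrBl mulrC mulrAC.
Qed.

(** * The ring of [p]-integral rationals *)

Section PIntegral.
Variables (p : nat) (hp : prime p).

(** Any denominator prime to [p] certifies integrality, reduced or not, so closure under sums and
    products only needs denominators to be multiplied. *)
Lemma p_integralP x :
  reflect (exists2 n : nat, ~~ (p %| n)%N & exists a : int, x * n%:R = a%:~R)
          (p_integral p x).
Proof.
apply: (iffP idP) => [hx | [n hn [a ha]]].
  exists `|denq x|%N => //; exists (numq x).
  by rewrite -[_%:R]/(Posz `|denq x|%N)%:~R absz_denq -numqE.
apply: contra hn => /dvdn_trans; apply.
have /eqP : (numq x * n)%:~R = (a * denq x)%:~R :> rat.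
  by rewrite !intrM -ha numqE; ring.
rewrite eqr_int => /eqP /(congr1 absz); rewrite !abszM /= => e.
have := dvdn_mull `|a|%N (dvdnn `|denq x|%N).
by rewrite -e Gauss_dvdr // coprime_sym coprime_num_den.
Qed.

Lemma p_integralD x y : p_integral p x -> p_integral p y -> p_integral p (x + y).
Proof.
move=> /p_integralP [n hn [a ha]] /p_integralP [m hm [b hb]]; apply/p_integralP.
exists (n * m)%N; first by rewrite Euclid_dvdM // negb_or hn.
by exists (a * m + b * n); rewrite intrD !intrM -ha -hb natrM /=; ring.
Qed.

Lemma p_integralM x y : p_integral p x -> p_integral p y -> p_integral p (x * y).
Proof.
move=> /p_integralP [n hn [a ha]] /p_integralP [m hm [b hb]]; apply/p_integralP.
exists (n * m)%N; first by rewrite Euclid_dvdM // negb_or hn.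
by exists (a * b); rewrite intrM -ha -hb natrM /=; ring.
Qed.

Lemma p_integral_int (a : int) : p_integral p a%:~R.
Proof. by rewrite /p_integral denq_int dvdn1 neq_ltn prime_gt1 ?orbT. Qed.

Lemma p_integral_nat (n : nat) : p_integral p n%:R.
Proof. exact: (p_integral_int n). Qed.

Lemma p_integralN x : p_integral p x -> p_integral p (- x).
Proof. by move=> hx; rewrite -mulN1r; apply: p_integralM => //; apply: (p_integral_int (-1)). Qed.

Lemma p_integralB x y : p_integral p x -> p_integral p y -> p_integral p (x - y).
Proof. by move=> hx hy; apply: p_integralD => //; apply: p_integralN. Qed.

Lemma p_integralX x n : p_integral p x -> p_integral p (x ^+ n).
Proof.
move=> hx; elim: n => [|n IH]; first exact: (p_integral_nat 1).
by rewrite exprS; apply: p_integralM.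
Qed.

(* The matching is purely syntactic because unifying a ring expression with
   [_%:R] does not terminate in practice. *)
Ltac p_int := repeat match goal with
  | |- is_true (p_integral _ (_%:R)) => apply: p_integral_nat
  | |- is_true (p_integral _ (_ + _)) => apply: p_integralD
  | |- is_true (p_integral _ (- _)) => apply: p_integralN
  | |- is_true (p_integral _ (_ * _)) => apply: p_integralM
  | |- is_true (p_integral _ (_ ^+ _)) => apply: p_integralX
  | |- is_true (p_integral _ _) => assumption
  end.

Lemma p_integral_sum (I : eqType) (r : seq I) (F : I -> rat) :
  (forall i, i \in r -> p_integral p (F i)) -> p_integral p (\sum_(i <- r) F i).
Proof.
move=> hF; rewrite big_seq; elim/big_ind: _ => //.
  exact: (p_integral_nat 0).
exact: p_integralD.
Qed.

Lemma p_integralV (n : nat) : ~~ (p %| n)%N -> p_integral p n%:R^-1.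
Proof.
move=> hn; apply/p_integralP; exists n => //; exists 1.
by rewrite mulVf // pnatr_eq0; apply: contraNneq hn => ->.
Qed.

Lemma p_integralV_lt k : (0 < k < p)%N -> p_integral p k%:R^-1.
Proof. by move=> /andP [k0 kp]; apply: p_integralV; rewrite gtnNdvd. Qed.

Lemma prime_rat_neq0 : p%:R != 0 :> rat.
Proof. by rewrite pnatr_eq0 -lt0n prime_gt0. Qed.

(** * Divisibility by [p]; power sums and harmonic sums modulo [p] *)

Definition p_divides (x : rat) := p_integral p (x / p%:R).

Lemma p_dividesP x : reflect (exists2 c, p_integral p c & x = p%:R * c) (p_divides x).
Proof.
apply: (iffP idP) => [hx|[c hc ->]]; last by rewrite /p_divides mulrAC divff ?mul1r ?prime_rat_neq0.
by exists (x / p%:R) => //; rewrite mulrC divfK // prime_rat_neq0.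
Qed.

Lemma p_dividesD x y : p_divides x -> p_divides y -> p_divides (x + y).
Proof. by rewrite /p_divides mulrDl; apply: p_integralD. Qed.

Lemma p_dividesN x : p_divides x -> p_divides (- x).
Proof. by rewrite /p_divides mulNr; apply: p_integralN. Qed.

Lemma p_dividesMl x y : p_integral p x -> p_divides y -> p_divides (x * y).
Proof. by rewrite /p_divides -mulrA; apply: p_integralM. Qed.

Lemma p_divides_sum (I : eqType) (r : seq I) (F : I -> rat) :
  (forall i, i \in r -> p_divides (F i)) -> p_divides (\sum_(i <- r) F i).
Proof. by move=> hF; rewrite /p_divides mulr_suml; apply: p_integral_sum. Qed.

Lemma p_divides_nat n : (p %| n)%N -> p_divides n%:R.
Proof.
move=> /dvdnP [q ->]; apply/p_dividesP; exists q%:R; first exact: p_integral_nat.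
by rewrite natrM mulrC.
Qed.

(** Telescoping [(k + 1)^(a+1) - k^(a+1)] expresses [p^(a+1)] through the power sums of exponent at
    most [a]. With [0^0 = 1], the term [k = 0] makes the sum of exponent [0] equal to [p]. *)
Lemma dvdn_sum_pow a : (a < p.-1)%N -> (p %| \sum_(0 <= k < p) k ^ a)%N.
Proof.
have [n] := ubnP a; elim: n a => // n IH a /ltnSE an ap.
have E : (p ^ a.+1 = \sum_(i < a.+1) 'C(a.+1, i) * \sum_(0 <= k < p) k ^ i)%N.
  transitivity (\sum_(0 <= k < p) (k.+1 ^ a.+1 - k ^ a.+1))%N.
    by rewrite telescope_sumn ?exp0n ?subn0 // => i j ij; rewrite leq_exp2r.
  under [RHS]eq_bigr => i _ do rewrite big_distrr /=.
  rewrite exchange_big /=; apply: eq_bigr => k _.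
  rewrite -addn1 addnC expnDn big_ord_recr /= subnn exp1n binn !mul1n addnK.
  by apply: eq_bigr => i _; rewrite exp1n mul1n.
have : (p %| p ^ a.+1)%N by rewrite dvdn_exp.
rewrite E big_ord_recr /= dvdn_addr; last first.
  by apply: dvdn_sum => i _; apply/dvdn_mull/IH; have := ltn_ord i; lia.
(* The top power sum has coefficient [a + 1 < p], which is prime to [p]. *)
rewrite Euclid_dvdM // binSn gtnNdvd //=; lia.
Qed.

Lemma p_divides_sum_pow a : (0 < a < p.-1)%N -> p_divides (\sum_(1 <= k < p) k%:R ^+ a).
Proof.
move=> /andP [a0 ap]; have := dvdn_sum_pow ap.
rewrite big_ltn ?prime_gt0 // exp0n // add0n => /p_divides_nat.
by rewrite natr_sum; under eq_bigr => k _ do rewrite natrX.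
Qed.

Lemma harm2_pred a : harm2 p.-1 a = \sum_(1 <= k < p) (k%:R ^+ a)^-1.
Proof. by rewrite /harm2 prednK // prime_gt0. Qed.

Lemma fermat_p_divides k : (0 < k < p)%N -> p_divides (k%:R ^+ p.-1 - 1).
Proof.
move=> /andP [k0 kp].
have /Euler_exp_totient : coprime k p by rewrite coprime_sym prime_coprime // gtnNdvd.
rewrite totient_prime // => /eqP; rewrite eqn_mod_dvd ?expn_gt0 ?k0 // => /p_divides_nat.
by rewrite natrB ?expn_gt0 ?k0 // natrX.
Qed.

(** By Fermat, [k^(-a)] may be replaced by [k^(p-1-a)] modulo [p], leaving a power sum. *)
Lemma p_divides_harm2 a : (0 < a < p.-1)%N -> p_divides (harm2 p.-1 a).
Proof.
move=> /andP [a0 ap]; rewrite harm2_pred.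
rewrite (eq_big_nat _ _ (F2 := fun k => k%:R ^+ (p.-1 - a) +
   - ((k%:R^-1) ^+ a * (k%:R ^+ p.-1 - 1)))); last first.
  move=> k /andP [k0 _]; rewrite -{2}(subnK (ltnW ap)) exprD -exprVn.
  have kn : k%:R != 0 :> rat by rewrite pnatr_eq0 -lt0n.
  have : k%:R^-1 ^+ a * k%:R ^+ a = 1 :> rat by rewrite -exprMn mulVf // expr1n.
  by set u := _^-1 ^+ a; set v := k%:R ^+ a => e; rewrite mulrBr mulrCA e; ring.
rewrite big_split /=; apply: p_dividesD; first by apply: p_divides_sum_pow; lia.
apply: p_divides_sum => k; rewrite mem_index_iota => hk.
apply/p_dividesN/p_dividesMl; last exact: fermat_p_divides.
by apply/p_integralX/p_integralV_lt.
Qed.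

Lemma sum_rev (F : nat -> rat) :
  \sum_(1 <= k < p) F k = \sum_(1 <= k < p) F (p - k)%N.
Proof. by rewrite big_nat_rev; apply: eq_bigr => k _; rewrite add1n subSS. Qed.

Lemma p_integral_harm2 n a : (n < p)%N -> p_integral p (harm2 n a).
Proof.
move=> np; apply: p_integral_sum => k; rewrite mem_index_iota => hk.
by rewrite -exprVn; apply/p_integralX/p_integralV_lt; lia.
Qed.

(** * Reflection [k -> p - k] and congruences modulo higher powers of [p] *)

Section AtLeastSeven.
Hypothesis hp7 : (7 <= p)%N.

Let p_integralV2 : p_integral p 2%:R^-1.
Proof. by apply: p_integralV_lt; lia. Qed.

Let p_integralV3 : p_integral p 3%:R^-1.
Proof. by apply: p_integralV_lt; lia. Qed.

(** Modulo [p^2], [1 / k^3 + 1 / (p - k)^3] is [- 3 p / k^4], and [p] divides [H_(p-1,4)] because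
    [4 < p - 1]. *)
Lemma harm2_3_eq : exists2 c, p_integral p c & harm2 p.-1 3 = p%:R ^+ 2 * c.
Proof.
have /p_dividesP [z4 hz4 e4] : p_divides (harm2 p.-1 4) by apply: p_divides_harm2; lia.
(* The exact remainder: [u + v = p u v] gives [u^3 + v^3 = p^3 u^3 v^3 - 3 p u^2 v^2], where
   [u^2 v^2 = u^4 (p v - 1)^2]. *)
pose R := \sum_(1 <= k < p) (let u := k%:R^-1 in let v := (p - k)%:R^-1 in
  p%:R * u ^+ 3 * v ^+ 3 + 6%:R * u ^+ 4 * v - 3%:R * p%:R * u ^+ 4 * v ^+ 2 : rat).
have E : harm2 p.-1 3 *+ 2 = - 3%:R * p%:R * harm2 p.-1 4 + p%:R ^+ 2 * R.
  rewrite mulr2n {2}harm2_pred sum_rev !harm2_pred -big_split /= !mulr_sumr -big_split /=.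
  apply: eq_big_nat => k /andP [k0 kp]; rewrite natrB ?(ltnW kp) //.
  have kn : k%:R != 0 :> rat by rewrite pnatr_eq0 -lt0n.
  have pkn : p%:R - k%:R != 0 :> rat by rewrite -natrB ?(ltnW kp) // pnatr_eq0 -lt0n subn_gt0.
  by field; rewrite ?kn ?pkn.
have hR : p_integral p R.
  apply: p_integral_sum => k; rewrite mem_index_iota => hk /=.
  have hu := p_integralV_lt hk.
  have hv : p_integral p (p - k)%:R^-1 by apply: p_integralV_lt; lia.
  by p_int.
exists (2%:R^-1 * (- 3%:R * z4 + R)); first by p_int.
have -> : harm2 p.-1 3 = 2%:R^-1 * (harm2 p.-1 3 *+ 2) by field.
by rewrite E e4; ring.
Qed.

(** With [u = 1 / k] and [v = 1 / (p - k)], iterating [v = - u + p u v] gives [v = - u - p u^2 - p^2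
    u^3 - p^3 u^4 + p^4 u^4 v]; summing leaves [H_(p-1,3)] and [H_(p-1,4)], divisible by [p^2] and
    [p]. *)
Lemma harm2_12_eq : exists2 w, p_integral p w &
  2%:R * harm p.-1 + p%:R * harm2 p.-1 2 = p%:R ^+ 4 * w.
Proof.
have /p_dividesP [z4 hz4 e4] : p_divides (harm2 p.-1 4) by apply: p_divides_harm2; lia.
have [z3 hz3 e3] := harm2_3_eq.
pose R := \sum_(1 <= k < p) (k%:R^-1 ^+ 4 * (p - k)%:R^-1 : rat).
have hR : p_integral p R.
  apply: p_integral_sum => k; rewrite mem_index_iota => hk /=.
  apply: p_integralM; first exact/p_integralX/p_integralV_lt.
  by apply: p_integralV_lt; lia.
exists (- z3 - z4 + R); first by p_int.
transitivity (- p%:R ^+ 2 * harm2 p.-1 3 - p%:R ^+ 3 * harm2 p.-1 4 + p%:R ^+ 4 * R); last first.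
  by rewrite e3 e4; ring.
rewrite mulr_natl mulr2n /harm {2}harm2_pred sum_rev !harm2_pred.
rewrite !mulr_sumr -sumrN -!big_split /=.
apply: eq_big_nat => k /andP [k0 kp]; rewrite natrB ?(ltnW kp) //.
have kn : k%:R != 0 :> rat by rewrite pnatr_eq0 -lt0n.
have pkn : p%:R - k%:R != 0 :> rat by rewrite -natrB ?(ltnW kp) // pnatr_eq0 -lt0n subn_gt0.
by field; rewrite ?kn ?pkn.
Qed.

(** * Integrality of the coefficients, and the cubic one modulo [p] *)

Lemma p_integral_coef_binom_poly k i : (k < p)%N -> p_integral p (binom_poly k)`_i.
Proof.
elim: k i => [|k IH] i kp.
  by rewrite binom_poly0 coef1; apply: p_integral_nat.
case: i => [|i]; first by rewrite coef0_binom_poly; apply: (p_integral_nat 1).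
rewrite coefS_binom_polyS; apply: p_integralB; first exact/IH/ltnW.
by apply: p_integralM; [apply: p_integralV_lt | apply/IH/ltnW].
Qed.

Lemma p_integral_coef_binom_sum_poly i : p_integral p (binom_sum_poly p.-1)`_i.
Proof.
rewrite coef_binom_sum_poly; apply: p_integral_sum => k.
rewrite mem_index_iota (prednK (prime_gt0 hp)) => hk.
apply: p_integralM; first exact: p_integralV_lt.
by apply: p_integral_coef_binom_poly; case/andP: hk.
Qed.

Lemma p_divides_inv_add k : (0 < k < p)%N -> p_divides (k%:R^-1 + (p - k)%:R^-1).
Proof.
move=> hk; apply/p_dividesP; exists (k%:R^-1 * (p - k)%:R^-1).
  by apply: p_integralM; apply: p_integralV_lt; lia.
have [k0 kp] := andP hk; rewrite natrB ?(ltnW kp) //.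
have kn : k%:R != 0 :> rat by rewrite pnatr_eq0 -lt0n.
have pkn : p%:R - k%:R != 0 :> rat by rewrite -natrB ?(ltnW kp) // pnatr_eq0 -lt0n subn_gt0.
by field; rewrite ?kn ?pkn.
Qed.

(** Induction from [H_(p-1)] at [m = 0]: each step subtracts a reflected pair
    [1 / k + 1 / (p - k)]. *)
Lemma p_divides_harm_rev m : (m < p)%N -> p_divides (harm (p.-1 - m) - harm m).
Proof.
elim: m => [_|m IH mp].
  by rewrite subn0 {2}/harm harm2_0 subr0; apply: p_divides_harm2; lia.
have -> : harm (p.-1 - m.+1) - harm m.+1 =
    (harm (p.-1 - m) - harm m) - (m.+1%:R^-1 + (p - m.+1)%:R^-1).
  have -> : (p.-1 - m = (p.-1 - m.+1).+1)%N by lia.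
  rewrite !harmS; have -> : (p - m.+1 = (p.-1 - m.+1).+1)%N by lia.
  by ring.
by apply: p_dividesD; [apply/IH/ltnW | apply/p_dividesN/p_divides_inv_add].
Qed.

(* The reflection [m -> p - m] turns the sum [T] into [- T] modulo [p]. *)
Lemma p_divides_sum_harm_cube : p_divides (\sum_(1 <= m < p) harm m.-1 / m%:R ^+ 3).
Proof.
set T := \sum_(_ <= _ < _) _.
(* The reflected pair plus [1 / m^4], from [H_(m-1) = H_m - 1 / m] and the factorization of a sum of
   two cubes; each summand has a factor divisible by [p]. *)
pose f m := (harm (p.-1 - m) - harm m) * (p - m)%:R^-1 ^+ 3 +
  harm m * (m%:R^-1 ^+ 2 - m%:R^-1 * (p - m)%:R^-1 + (p - m)%:R^-1 ^+ 2) *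
  (m%:R^-1 + (p - m)%:R^-1).
have E : T + T = - harm2 p.-1 4 + \sum_(1 <= m < p) f m.
  rewrite {2}/T sum_rev harm2_pred -sumrN -!big_split /=.
  apply: eq_big_nat => m /andP [m0 mp].
  have -> : ((p - m).-1 = p.-1 - m)%N by lia.
  rewrite /f; case: m m0 mp => // m _ mp; rewrite harmS /= -!exprVn; ring.
have -> : T = 2%:R^-1 * (T + T) by field.
rewrite E; apply: p_dividesMl => //; apply: p_dividesD.
  by apply/p_dividesN/p_divides_harm2; lia.
apply: p_divides_sum => m; rewrite mem_index_iota => hm.
have hu := p_integralV_lt hm.
have hv : p_integral p (p - m)%:R^-1 by apply: p_integralV_lt; lia.
have hh : p_integral p (harm m) by apply: p_integral_harm2; case/andP: hm.
have ha : p_divides (harm (p.-1 - m) - harm m) by apply: p_divides_harm_rev; case/andP: hm.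
rewrite /f [X in X + _]mulrC; apply: p_dividesD; apply: p_dividesMl => //; last first.
- exact: p_divides_inv_add.
- by p_int.
- by p_int.
Qed.

Lemma p_divides_sum_pow_div_cube i : (i < p)%N -> i != 3%N ->
  p_divides (\sum_(1 <= m < p) m%:R ^+ i / m%:R ^+ 3).
Proof.
move=> ip i3; have [i3'|i3'] := ltnP i 3.
  have : p_divides (harm2 p.-1 (3 - i)) by apply: p_divides_harm2; lia.
  rewrite harm2_pred; congr (p_divides _); apply: eq_big_nat => m /andP [m0 _].
  rewrite -{2}(subnK (ltnW i3')) exprD invfM mulrA mulrAC divff ?mul1r //.
  by rewrite expf_neq0 // pnatr_eq0 -lt0n.
have : p_divides (\sum_(1 <= m < p) m%:R ^+ (i - 3)) by apply: p_divides_sum_pow; lia.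
congr (p_divides _); apply: eq_big_nat => m /andP [m0 _].
by rewrite -{2}(subnK i3') exprD mulfK // expf_neq0 // pnatr_eq0 -lt0n.
Qed.

(* The sums [sum_m m^(i - 3)] over nonzero residues vanish modulo [p] for all
   [i < p] except [i = 3], so [sum_m Q(m) / m^3] extracts the coefficient. *)
Lemma p_divides_coef3_binom_sum_poly : p_divides (binom_sum_poly p.-1)`_3.
Proof.
pose c i := (binom_sum_poly p.-1)`_i.
pose s i : rat := \sum_(1 <= m < p) m%:R ^+ i / m%:R ^+ 3.
have E : - \sum_(1 <= m < p) harm m.-1 / m%:R ^+ 3 = \sum_(i < p) c i * s i.
  rewrite /s; under [RHS]eq_bigr => i _ do rewrite mulr_sumr.
  rewrite exchange_big -sumrN; apply: eq_big_nat => m /andP [m0 mp].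
  rewrite -mulNr -(@horner_binom_sum_poly p.-1); last by lia.
  have sz : (size (binom_sum_poly p.-1) <= p)%N.
    by rewrite -{2}(prednK (prime_gt0 hp)) size_binom_sum_poly.
  rewrite prednK // (horner_coef_wide _ sz) mulr_suml.
  by apply: eq_bigr => i _; rewrite mulrA.
have p3 : (3 < p)%N by lia.
rewrite (bigD1 (Ordinal p3)) //= in E.
(* The exceptional sum is [-1] modulo [p], so the coefficient itself is isolated. *)
have s3 : s 3%N = p%:R - 1.
  rewrite /s (eq_big_nat _ _ (F2 := fun=> 1)) => [|m /andP [m0 _]]; last first.
    by rewrite divff // expf_neq0 // pnatr_eq0 -lt0n.
  by rewrite sumr_const_nat natrB ?prime_gt0.
have -> : (binom_sum_poly p.-1)`_3 = \sum_(1 <= m < p) harm m.-1 / m%:R ^+ 3 +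
    c 3%N * p%:R + \sum_(i < p | i != Ordinal p3) c i * s i.
  by rewrite -[X in X + _ + _]opprK E s3 /c; ring.
apply: p_dividesD; first apply: p_dividesD.
- exact: p_divides_sum_harm_cube.
- by apply: p_dividesMl; [apply: p_integral_coef_binom_sum_poly | apply: p_divides_nat].
rewrite -big_filter; apply: p_divides_sum => i; rewrite mem_filter => /andP [i3 _].
apply: p_dividesMl; first exact: p_integral_coef_binom_sum_poly.
by apply: p_divides_sum_pow_div_cube.
Qed.

(** * Evaluation of [Q] at [p] and the resulting congruences *)

Lemma horner_binom_sum_poly_prime : exists2 R, p_integral p R &
  let c i := (binom_sum_poly p.-1)`_i in
  - harm p.-1 = c 0%N + c 1%N * p%:R + c 2%N * p%:R ^+ 2 + p%:R ^+ 4 * R.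
Proof.
have [d hd ed] := p_dividesP _ p_divides_coef3_binom_sum_poly.
pose c i := (binom_sum_poly p.-1)`_i.
pose R := \sum_(4 <= i < p) c i * p%:R ^+ (i - 4).
have hR : p_integral p R.
  apply: p_integral_sum => i _.
  by apply: p_integralM; [apply: p_integral_coef_binom_sum_poly | p_int].
(* [d] comes from the cubic term, whose coefficient supplies the fourth factor [p]; [R] collects the
   degrees from [4] on. *)
exists (d + R); first by p_int.
rewrite /= -(@horner_binom_sum_poly p.-1) // prednK ?prime_gt0 //.
have sz : (size (binom_sum_poly p.-1) <= p)%N.
  by rewrite -{2}(prednK (prime_gt0 hp)) size_binom_sum_poly.
rewrite (horner_coef_wide _ sz) -(big_mkord xpredT (fun i => c i * p%:R ^+ i)).
rewrite 4?big_ltn; try lia.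
have -> : \sum_(4 <= i < p) c i * p%:R ^+ i = p%:R ^+ 4 * R.
  rewrite mulr_sumr; apply: eq_big_nat => i /andP [i4 _].
  by rewrite mulrCA -exprD subnKC.
by rewrite /c ed; ring.
Qed.
(** Wolstenholme's congruence, read off from [2 H_(p-1) + p H_(p-1,2)] and [p | H_(p-1,2)]. *)
Lemma harm_eq : exists2 z1, p_integral p z1 & harm p.-1 = p%:R ^+ 2 * z1.
Proof.
have [w hw ew] := harm2_12_eq.
have /p_dividesP [z2 hz2 e2] : p_divides (harm2 p.-1 2) by apply: p_divides_harm2; lia.
exists (2%:R^-1 * (p%:R ^+ 2 * w - z2)); first by p_int.
have -> : harm p.-1 = 2%:R^-1 * ((2%:R * harm p.-1 + p%:R * harm2 p.-1 2)
                                 - p%:R * harm2 p.-1 2) by field.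
by rewrite ew e2; ring.
Qed.

Lemma cong_rat_sum_sqr_harm :
  cong_rat p 2 (\sum_(1 <= k < p) harm k / k%:R ^+ 2)
               (\sum_(1 <= k < p) harm k ^+ 2 / k%:R).
Proof.
have [z1 hz1 e1] := harm_eq; have [z3 hz3 e3] := harm2_3_eq.
have := sum_sqr_harm p.-1; rewrite prednK ?prime_gt0 // e1 e3 => ->.
set S1 := \sum_(_ <= _ < _) _; have p0 := prime_rat_neq0; rewrite /cong_rat.
have -> : (S1 - (S1 + ((p%:R ^+ 2 * z1) ^+ 3 - p%:R ^+ 2 * z3) / 3%:R)) / p%:R ^+ 2
  = 3%:R^-1 * (z3 - p%:R ^+ 4 * z1 ^+ 3) by field.
by p_int.
Qed.

(** The difference is [- 3 / (2 p^2)] times [2 H_(p-1) + p H_(p-1,2)]. *)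
Lemma cong_rat_harm_harm2 :
  cong_rat p 2 (- 3%:R / (p%:R ^+ 2) * harm p.-1)
               (3%:R / (2%:R * p%:R) * harm2 p.-1 2).
Proof.
have [w hw ew] := harm2_12_eq; have p0 := prime_rat_neq0; rewrite /cong_rat.
have -> : (- 3%:R / p%:R ^+ 2 * harm p.-1 - 3%:R / (2%:R * p%:R) * harm2 p.-1 2) /
    p%:R ^+ 2 = - 3%:R * 2%:R^-1 *
                ((2%:R * harm p.-1 + p%:R * harm2 p.-1 2) / p%:R ^+ 4) by field.
by rewrite ew [_ ^+ 4 * w]mulrC mulfK ?expf_neq0 //; p_int.
Qed.

(** In the relation at [p], the terms [2 H_(p-1)] and [- p H_(p-1,2) / 2] add up to [3 H_(p-1)]
    modulo [p^4], while [p^2 (S1 + S2) / 2] becomes [p^2 S1]. *)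
Lemma cong_rat_sum_harm_harm :
  cong_rat p 2 (\sum_(1 <= k < p) harm k / k%:R ^+ 2)
               (- 3%:R / (p%:R ^+ 2) * harm p.-1).
Proof.
have p0 := prime_rat_neq0.
have [w hw ew] := harm2_12_eq; have [R hR eR] := horner_binom_sum_poly_prime.
have [z1 hz1 e1] := harm_eq; have [z3 hz3 e3] := harm2_3_eq.
move: eR; rewrite /= coef0_binom_sum_poly coef1_binom_sum_poly coef2_binom_sum_poly.
rewrite sum_sqr_harm prednK ?prime_gt0 //; set S1 := \sum_(_ <= _ < _) _.
move=> eR; have e2 : harm2 p.-1 2 = p%:R ^+ 3 * w - 2%:R * p%:R * z1.
  apply: (mulfI p0); apply: (addrI (2%:R * harm p.-1)).
  by rewrite ew e1; ring.
move: eR; rewrite e1 e2 e3; set E := (X in _ = X) => eR; rewrite /cong_rat.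
(* This is [H_(p-1,2) / p]. *)
pose z2 := p%:R ^+ 2 * w - 2%:R * z1.
(* An identity in free variables: the last summand is the defect of the relation at [p], which [eR]
   makes zero. *)
have -> : (S1 - - 3%:R / p%:R ^+ 2 * (p%:R ^+ 2 * z1)) / p%:R ^+ 2 =
    2%:R^-1 * (w + z1 ^+ 2 * p%:R + p%:R * z1 * z2 + z3) - R
    - 2%:R^-1 * 3%:R^-1 * (p%:R ^+ 4 * z1 ^+ 3 - z3)
    + (E - - (p%:R ^+ 2 * z1)) / p%:R ^+ 4 by rewrite /E /z2; field.
by rewrite -eR subrr mul0r addr0 /z2; p_int.
Qed.
End AtLeastSeven.
End PIntegral.

Theorem theorem1p1 (p : nat) (hp : prime p) (hp7 : (7 <= p)%N) :
  let S1 := \sum_(1 <= k < p) harm k / (k%:R ^+ 2) in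
  let S2 := \sum_(1 <= k < p) (harm k) ^+ 2 / k%:R in
  let S3 := - 3%:R / (p%:R ^+ 2) * harm p.-1 in
  let S4 := 3%:R / (2%:R * p%:R) * harm2 p.-1 2 in
  [/\ cong_rat p 2 S1 S2, cong_rat p 2 S2 S3 & cong_rat p 2 S3 S4].
Proof.
move=> S1 S2 S3 S4.
have h12 : cong_rat p 2 S1 S2 by apply: cong_rat_sum_sqr_harm.
have h13 : cong_rat p 2 S1 S3 by apply: cong_rat_sum_harm_harm.
split=> //; last exact: cong_rat_harm_harm2.
rewrite /cong_rat; have -> : S2 - S3 = (S1 - S3) - (S1 - S2) by ring.
by rewrite mulrBl; apply: p_integralB.
Qed.
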